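(* Let $k\ge3$. Let $\Delta$ be a family of inequalities $\mathbf q\preceq\mathbf u$, each of which holds in $S_c^*(a_1\cdots a_k)$, where $\mathbf q$ is a word and $\mathbf u$ is a term. Suppose that $N\ge1$ and that $|\mathbf u|\le N$ for every inequality $\mathbf q\preceq\mathbf u$ in $\Delta$. Let $\mathbb H$ be a finite $k$-uniform hypergraph with girth $g(\mathbb H)>N$. If a term $\mathbf t$ satisfies $(P_{\mathbb H})$ and $\mathbf t'$ is obtained from $\mathbf t$ by one elementary application of an identity in $\Delta$, then $\mathbf t'$ also satisfies $(P_{\mathbb H})$.
   Context: Semirings. An ai-semiring is an algebra $(S,+,\cdot)$ such that $(S,+)$ is a commutative idempotent semigroup, $(S,\cdot)$ is a semigroup, and both distributive laws hold. Let $a_1,\dots,a_k$ be distinct letters. The semiring $S_c^*(a_1\cdots a_k)$ has as its nonzero elements all nonempty square-free commutative words on $\{a_1,\ldots,a_k\}$, together with an element $0$ absorbing for both addition and multiplication. For nonzero $u,v$: $u+v$ is the square-free word whose set of letters is the union of the sets of letters of $u$ and $v$; $u\cdot v$ is the square-free word $uv$ if $u,v$ have no letter in common, and $0$ otherwise. Terms. $X$ is a countably infinite set of variables, $X_c^+$ the free commutative semigroup on $X$; its elements (nonempty commutative words) are called words. A (normalized) term is a finite nonempty subset of $X_c^+$, thought of as the sum of its words; terms form the free commutative ai-semiring $P_f(X_c^+)$, with addition the union and multiplication the setwise product. $|\mathbf u|$ is the number of words of $\mathbf u$; $\mathbf w\in\mathbf u$ means $\mathbf w$ is one of the words of $\mathbf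 u$. A word is identified with the corresponding one-element term. The content $c(\mathbf w)$ of a word is the set of variables occurring in it; a word is linear if each variable of its content occurs exactly once. The inequality $\mathbf q\preceq\mathbf u$ denotes the identity $\mathbf q+\mathbf u\approx\mathbf u$, also interpreted as $\mathbf u\approx\mathbf u+\mathbf q$. Elementary application. A substitution is an endomorphism $\varphi$ of $P_f(X_c^+)$. The term $\mathbf t'$ is obtained from $\mathbf t$ by one elementary application of an identity in $\Delta$ if there are $(\mathbf q\preceq\mathbf u)\in\Delta$, a substitution $\varphi$, a $\mathbf p$ which is a term or the formal empty word $1$ (no multiplicative context), and a $\mathbf d$ which is a term or is omitted (no additive context), such that $\{\mathbf t,\mathbf t'\}$ consists of $$\mathbf p\varphi(\mathbf u)+\mathbf d\quad\text{and}\quad \mathbf p\varphi(\mathbf u)+\mathbf p\varphi(\mathbf q)+\mathbf d,$$ in either order (either one may be $\mathbf t$). Hypergraphs. A finite hypergraph is a pair $\mathbb H=(V,E)$ with $V$ finite and $E$ a family (set) of nonempty subsets of $V$ (hyperedges). It is $k$-uniform if every hyperedge has exactly $k$ vertices. A subset of $V$ contained in some hyperedge is a subhyperedge. A Berge cycle of length $m\ge2$ is a sequence $v_1,e_1,v_2,e_2,\ldots,v_m,e_m,v_1$ with $v_1,\ldots,v_m$ distinct vertices, $e_1,\ldots,e_m$ distinct hyperedges, $\{v_i,v_{i+1}\}\subseteq e_i$ for $1\le i<m$ and $\{v_m,v_1\}\subseteq e_m$. The girth $g(\mathbb H)$ is the length of a shortest Berge cycle, and $\infty$ if there is none. Property $(P_{\mathbb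 H})$. Fix pairwise distinct variables $x_v\in X$, $v\in V(\mathbb H)$. A term $\mathbf t$ satisfies $(P_{\mathbb H})$ if every word $\mathbf w\in\mathbf t$ is linear and its content is of the form $c(\mathbf w)=\{x_v:v\in B\}$ for a subhyperedge $B$ of $\mathbb H$. *)

(* Defs.v *)
From mathcomp Require Import all_boot.
From mathcomp Require Import finmap multiset.

Set Implicit Arguments.
Unset Strict Implicit.
Unset Printing Implicit Defensive.

Local Open Scope fset_scope.
Local Open Scope nat_scope.

(* Words: the free commutative semigroup over the countably infinite set of
   variables X = nat.  The word w contains the variable y exactly w y times. *)

Definition word : Type := {w : {mset nat}%mset | w != mset0}.

Fact word_mul_subproof (v w : word) : msetD (val v) (val w) != mset0.
Proof.
apply: contraNneq (valP v) => vw0; apply/eqP/msetP => y.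
move/msetP/(_ y): vw0; rewrite msetE2 !mset0E => /eqP.
by rewrite addn_eq0 => /andP[/eqP].
Qed.

Definition word_mul (v w : word) : word :=
  Sub (msetD (val v) (val w)) (word_mul_subproof v w).

Definition content (w : word) : {fset nat} := finsupp (val w).

Definition linear (w : word) : Prop :=
  forall y, y \in content w -> val w y = 1.

(* Terms: the free commutative ai-semiring over X. *)

Definition term : Type := {t : {fset word} | t != fset0}.

Fact term_add_subproof (s t : term) : val s `|` val t != fset0.
Proof. by rewrite fsetU_eq0 negb_and (valP s). Qed.

Definition term_add (s t : term) : term :=
  Sub (val s `|` val t) (term_add_subproof s t).

Fact term_mul_subproof (s t : term) :
  [fset word_mul v w | v in val s, w in val t] != fset0.
Proof.
have /fset0Pn[v vs] := valP s; have /fset0Pn[w wt] := valP t.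
by apply/fset0Pn; exists (word_mul v w); apply/imfset2P; exists v => //; exists w.
Qed.

Definition term_mul (s t : term) : term :=
  Sub [fset word_mul v w | v in val s, w in val t] (term_mul_subproof s t).

Fact term_of_word_subproof (w : word) : [fset w] != fset0.
Proof. by apply/fset0Pn; exists w; rewrite inE. Qed.

Definition term_of_word (w : word) : term :=
  Sub [fset w] (term_of_word_subproof w).

Definition nwords (t : term) : nat := #|` val t|.

Definition substitution (phi : term -> term) : Prop :=
  {morph phi : s t / term_add s t} /\ {morph phi : s t / term_mul s t}.

(* The semiring S_c^*(a_1 ... a_k): the letters are the elements of 'I_k, a
   nonempty square-free commutative word is its set of letters, and None is 0. *)

Definition sfword (k : nat) : Type := {A : {set 'I_k} | A != set0}.

Definition Sc (k : nat) : Type := option (sfword k).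

Fact sfword_union_subproof k (A B : sfword k) : (val A :|: val B)%SET != set0.
Proof. by rewrite setU_eq0 negb_and (valP A). Qed.

Definition sfword_union k (A B : sfword k) : sfword k :=
  Sub (val A :|: val B)%SET (sfword_union_subproof A B).

Definition Sc_add k (u v : Sc k) : Sc k :=
  match u, v with
  | Some A, Some B => Some (sfword_union A B)
  | _, _ => None
  end.

Definition Sc_mul k (u v : Sc k) : Sc k :=
  match u, v with
  | Some A, Some B =>
      if [disjoint val A & val B]%B then Some (sfword_union A B) else None
  | _, _ => None
  end.

Lemma Sc_addC k : commutative (@Sc_add k).
Proof.
by case=> [A|] [B|] //=; congr Some; apply: val_inj; rewrite /= setUC.
Qed.

Lemma Sc_addA k : associative (@Sc_add k).
Proof.
by case=> [A|] [B|] [C|] //=; congr Some; apply: val_inj; rewrite /= setUA.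
Qed.

Lemma Sc_mulC k : commutative (@Sc_mul k).
Proof.
case=> [A|] [B|] //=; rewrite disjoint_sym; case: ifP => // _.
by congr Some; apply: val_inj; rewrite /= setUC.
Qed.

Lemma Sc_mulA k : associative (@Sc_mul k).
Proof.
case=> [A|] [B|] [C|] //=; last by case: ifP.
rewrite -!setI_eq0; case: (boolP (val B :&: val C == set0)%SET) => BC;
  case: (boolP (val A :&: val B == set0)%SET) => AB //=;
  rewrite -!setI_eq0 ?setIUr ?setIUl !setU_eq0.
- rewrite AB BC /= andbT.
  by case: ifP => // _; congr Some; apply: val_inj; rewrite /= setUA.
- by rewrite (negPf AB).
- by rewrite (negPf BC) andbF.
Qed.

(* Values in Sc k of words and terms under an assignment a of the variables.
   There being no neutral elements in Sc k, the iterated operations are taken in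
   option (Sc k), whose extra None is the value of an empty sum or product; it
   is never reached, words and terms being nonempty. *)

Definition eval_word k (a : nat -> Sc k) (w : word) : option (Sc k) :=
  \big[oAC (@Sc_mulA k) (@Sc_mulC k)/None]_(y <- val w) Some (a y).

Definition eval_term k (a : nat -> Sc k) (t : term) : option (Sc k) :=
  \big[oAC (@Sc_addA k) (@Sc_addC k)/None]_(w <- val t) eval_word a w.

Definition ineq_holds (k : nat) (q : word) (u : term) : Prop :=
  forall a : nat -> Sc k,
    eval_term a (term_add (term_of_word q) u) = eval_term a u.

Definition in_mul_context (p : option term) (t : term) : term :=
  if p is Some p' then term_mul p' t else t.

Definition in_add_context (d : option term) (t : term) : term :=
  if d is Some d' then term_add t d' else t.

Definition elementary_application (Delta : word -> term -> Prop)
    (t t' : term) : Prop :=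
  exists (q : word) (u : term) (phi : term -> term) (p d : option term),
    let lhs := in_add_context d (in_mul_context p (phi u)) in
    let rhs := in_add_context d
      (term_add (in_mul_context p (phi u))
                (in_mul_context p (phi (term_of_word q)))) in
    [/\ Delta q u, substitution phi &
        (t = lhs /\ t' = rhs) \/ (t = rhs /\ t' = lhs)].

Record hypergraph (V : finType) := Hypergraph {
  hyperedges : {set {set V}};
  hyperedges_nonempty : set0 \notin hyperedges }.

Section Hypergraph.

Variables (V : finType) (H : hypergraph V).

Definition uniform (k : nat) : Prop :=
  forall e : {set V}, e \in hyperedges H -> #|e| = k.

Definition subhyperedge (B : {set V}) : Prop :=
  exists2 e : {set V}, e \in hyperedges H & B \subset e.

(* ordS is the cyclic successor: it maps m.-1 to 0. *)
Definition berge_cycle (m : nat) (v : {ffun 'I_m -> V})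
    (e : {ffun 'I_m -> {set V}}) : bool :=
  [&& 2 <= m, injectiveb v, injectiveb e,
      [forall i, e i \in hyperedges H] &
      [forall i, [set v i; v (ordS i)]%SET \subset e i]].

Definition has_berge_cycle (m : nat) : bool :=
  [exists v : {ffun 'I_m -> V}, exists e : {ffun 'I_m -> {set V}},
    berge_cycle v e].

(* None is infinity.  The search is bounded by #|V| because the vertices of a
   Berge cycle are distinct. *)
Definition girth : option nat :=
  let m := find has_berge_cycle (iota 0 #|V|.+1) in
  if m <= #|V| then Some m else None.

Definition girth_gt (N : nat) : Prop :=
  if girth is Some g then N < g else True.

Lemma girth_gtP (N : nat) :
  girth_gt N <-> (forall m, has_berge_cycle m -> N < m).
Proof.
have bnd m : has_berge_cycle m -> m <= #|V|.
  case/existsP=> v /existsP[e /and5P[_ /injectiveP vI _ _ _]].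
  by have := leq_card v vI; rewrite card_ord.
have mem m : m <= #|V| -> m \in iota 0 #|V|.+1 by rewrite mem_iota.
rewrite /girth_gt /girth; set f := find _ _.
case: (leqP f #|V|) => [fV|fV]; split=> //.
- move=> Nf m cm; apply: leq_trans Nf _; rewrite leqNgt; apply/negP => mf.
  have := before_find 0 mf; rewrite nth_iota ?add0n ?cm //.
  by rewrite ltnS bnd.
- apply; have hf : has has_berge_cycle (iota 0 #|V|.+1).
    by rewrite has_find size_iota ltnS.
  by have := nth_find 0 hf; rewrite nth_iota ?add0n // ltnS.
- move=> _ m cm; have hf : has has_berge_cycle (iota 0 #|V|.+1).
    by apply/hasP; exists m => //; apply/mem/bnd.
  by move: hf; rewrite has_find size_iota ltnS leqNgt fV.
Qed.

Definition prop_P (x : V -> nat) (t : term) : Prop :=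
  forall w, w \in val t ->
    linear w /\
    exists2 B : {set V}, subhyperedge B & content w = [fset x v | v in B].

End Hypergraph.

(* Main.v *)
(* For every word w of u pick a hyperedge containing p * phi(w).  At most N
   hyperedges arise and the girth exceeds N, so they form an acyclic family F.
   Choose for each variable y a word sigma(y) of phi(y).  A colouring of the
   vertices by a_1, ..., a_k that is injective on every edge of F makes u nonzero
   under the assignment sending y to the colours occurring in sigma(y); hence q is
   nonzero as well, that is, q is linear with variables in u, and the colour sets
   of distinct variables of q are disjoint.  As k >= 3, two vertices not in a
   common edge of F can be given the same colour, so the vertices of p * sigma(q)
   are pairwise in common edges, and by acyclicity they all lie in one edge. *)

Require Import Defs.
From mathcomp Require Import all_boot all_fingroup.
From mathcomp Require Import finmap multiset.
From mathcomp Require Import zify.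

Set Implicit Arguments.
Unset Strict Implicit.
Unset Printing Implicit Defensive.

(** * Acyclic families of hyperedges *)

Section Acyclic.

Variable V : finType.
Implicit Types (F G : {set {set V}}) (e f : {set V}) (a b u v w : V).

Definition adj F : rel V := fun a b => [exists f in F, (a \in f) && (b \in f)].

Lemma adjP F a b :
  reflect (exists f, [/\ f \in F, a \in f & b \in f]) (adj F a b).
Proof.
apply: (iffP existsP) => [[f /and3P[]]|[f [fF af bf]]]; first by exists f.
by exists f; apply/and3P.
Qed.

Lemma adj_sym F : symmetric (adj F).
Proof. by move=> a b; apply: eq_existsb => f; rewrite [(a \in f) && _]andbC. Qed.

Lemma connect_adj_sym F : connect_sym (adj F).
Proof. exact/sym_connect_sym/adj_sym. Qed.

(** Berge-acyclicity, phrased as a bridge condition: once [e] is deleted, its vertices lie in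
    distinct components. *)
Definition acyclic F := forall e u v, e \in F -> u \in e -> v \in e ->
  connect (adj (F :\ e)) u v -> u = v.

Definition walk F (m : nat) (q : nat -> V) :=
  forall i, i < m -> adj F (q i) (q i.+1).

Lemma connect_shortest_walk F u v : connect (adj F) u v ->
  exists m (q : nat -> V), [/\ q 0 = u, q m = v, walk F m q &
    forall m' (q' : nat -> V), q' 0 = u -> q' m' = v -> walk F m' q' -> m <= m'].
Proof.
move=> /connectP[p0 p0P p0l].
pose P m := [exists p : m.-tuple V, path (adj F) u p && (last u p == v)].
have exP : exists m, P m.
  by exists (size p0); apply/existsP; exists (in_tuple p0); rewrite p0P p0l /=.
case: (ex_minnP exP) => m /existsP[p /andP[pP /eqP pl]] mmin.
exists m, (nth u (u :: p)); split=> //.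
- by rewrite -pl (last_nth u) size_tuple.
- by move=> i im; apply: (pathP u pP); rewrite size_tuple.
move=> m' q' q0 qm qw; apply: mmin; apply/existsP.
have sz : size (mkseq (fun i => q' i.+1) m') == m' by rewrite size_mkseq.
exists (Tuple sz) => /=; apply/andP; split.
- apply/(pathP u) => i; rewrite size_mkseq => im.
  rewrite nth_mkseq //; case: i im => [|i] im /=; first by rewrite -q0; apply: qw.
  by rewrite nth_mkseq ?(ltnW im) //; apply: qw.
- rewrite (last_nth u) size_mkseq; case: m' qm {qw sz} => [|m'] qm /=.
    by rewrite -q0 qm.
  by rewrite nth_mkseq // qm.
Qed.

(** The [l] vertices following [q i] are skipped. On a shortest walk this forces [l = 0]. *)
Lemma walk_shortcut F m (q : nat -> V) i l : walk F m q -> i + l < m ->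
  adj F (q i) (q (i + l).+1) ->
  walk F (m - l) (fun t => if t <= i then q t else q (t + l)).
Proof.
move=> qw ilm ad t tm; case: (ltngtP t i) => ti.
- by apply: qw; lia.
- by rewrite addSn; apply: qw; lia.
- by rewrite ti addSn.
Qed.

(** A shortest walk outside [e] between two distinct vertices of [e] repeats neither a vertex nor an
    edge, so closing it with [e] gives a Berge cycle. Its edges are distinct members of [F], so its
    length is at most [N]. *)
Lemma girth_gt_acyclic (H : hypergraph V) N F : girth_gt H N ->
  F \subset hyperedges H -> #|F| <= N -> acyclic F.
Proof.
move=> /girth_gtP gH /subsetP FH FN e u v eF ue ve.
move=> /connect_shortest_walk[m [q [q0 qm qw qmin]]].
apply/eqP; apply: contraT => uv.
have m0 : 0 < m by case: m qm {qw qmin} uv => //; rewrite q0 => ->; rewrite eqxx.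
have noshort i l : i + l < m -> adj (F :\ e) (q i) (q (i + l).+1) -> l = 0.
  move=> ilm ad; have := qmin _ _ _ _ (walk_shortcut qw ilm ad).
  rewrite /= q0; case: ifP => [mi|_]; first by lia.
  by rewrite subnK ?qm; [move=> /(_ erefl erefl); lia | lia].
(* If [q i = q j] with [j < m], the walk can jump from [q i] to [q j.+1]; if [j = m], it can stop at
   [i]. *)
have qinj i j : i < j -> j <= m -> q i <> q j.
  move=> ij jm qij; have [jlt|jeq] : j < m \/ j = m by lia.
    have := noshort i (j - i); rewrite subnKC ?(ltnW ij) // qij.
    by move=> /(_ jlt (qw _ jlt)); lia.
  have := qmin i q q0; rewrite qij jeq qm => /(_ erefl) h.
  by have : m <= i by [apply: h => t ti; apply: qw; lia]; lia.
(* The default [set0] is never reached along the walk, where consecutive vertices are adjacent. *)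
pose ed a b := odflt set0 [pick f in F :\ e | (a \in f) && (b \in f)].
have edP i : i < m -> [/\ ed (q i) (q i.+1) \in F :\ e, q i \in ed (q i) (q i.+1)
    & q i.+1 \in ed (q i) (q i.+1)].
  move=> /qw /adjP[f [fF af bf]]; rewrite /ed.
  case: pickP => [g /and3P[]//|/(_ f)]; by rewrite fF af bf.
(* An edge used twice contains both [q i] and [q j.+1], which is again a shortcut. *)
have edinj i j : i < j -> j < m -> ed (q i) (q i.+1) <> ed (q j) (q j.+1).
  move=> ij jm eij; have [iF ii _] := edP _ (ltn_trans ij jm).
  have [jF _ jj] := edP _ jm.
  have := noshort i (j - i); rewrite subnKC ?(ltnW ij) // => /(_ jm).
  have -> : adj (F :\ e) (q i) (q j.+1).
    by apply/adjP; exists (ed (q i) (q i.+1)); rewrite iF ii eij.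
  by move=> /(_ isT); lia.
pose cv : {ffun 'I_m.+1 -> V} := [ffun i : 'I_m.+1 => q i].
(* The last edge is [e], leading from [q m = v] back to [q 0 = u]. *)
pose ce : {ffun 'I_m.+1 -> {set V}} :=
  [ffun i : 'I_m.+1 => if i < m then ed (q i) (q i.+1) else e].
have ceF i : ce i \in F.
  rewrite ffunE; case: ifP => // im.
  by have [] := edP _ im; rewrite in_setD1 => /andP[].
have ceI : injective ce.
  have wl (i j : 'I_m.+1) : i < j -> ce i <> ce j.
    move=> ij; rewrite !ffunE; have im : i < m by have := ltn_ord j; lia.
    rewrite im; case: ifP => jm; first exact: edinj.
    by have [] := edP _ im; rewrite in_setD1 => /andP[/eqP].
  move=> i j ij; apply: val_inj => /=.
  by case: (ltngtP i j) => // /wl; rewrite ij.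
have cyc : has_berge_cycle H m.+1.
  apply/existsP; exists cv; apply/existsP; exists ce; apply/and5P; split=> //.
  - apply/injectiveP => i j; rewrite !ffunE => ij; apply: val_inj => /=.
    have := ltn_ord i; have := ltn_ord j; rewrite !ltnS => jm im.
    by case: (ltngtP i j) => // h; have := qinj _ _ h; rewrite ij; case.
  - exact/injectiveP.
  - by apply/forallP => i; apply/FH/ceF.
  - apply/forallP => i; rewrite subUset !sub1set !ffunE /=.
    case: ifP => im; first by have [] := edP _ im; rewrite modn_small // => _ -> ->.
    have -> : (i : nat) = m by have := ltn_ord i; lia.
    by rewrite modnn qm q0 ve.
have := gH _ cyc; rewrite ltnNge (leq_trans _ FN) //.
have /subset_leq_card : [set ce i | i : 'I_m.+1] \subset F.
  by apply/subsetP => f /imsetP[i _ ->].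
by rewrite card_imset // card_ord.
Qed.

Lemma adjS F G : F \subset G -> subrel (adj F) (adj G).
Proof.
move=> /subsetP FG a b /adjP[f [fF af bf]]; apply/adjP; exists f.
by rewrite FG.
Qed.

Lemma acyclicS F G : F \subset G -> acyclic G -> acyclic F.
Proof.
move=> FG acG e u v eF ue ve uv; apply: (acG e) => //.
  exact: (subsetP FG).
apply: connect_sub uv => a b ab; apply: connect1.
by apply: adjS ab; apply: setSD.
Qed.

(** Take an edge [f] through two distinct vertices [a], [b] of [S]. A vertex [c] of [S] outside [f]
    would join [a] to [b] by edges other than [f]. *)
Lemma acyclic_clique F (S : {set V}) : acyclic F -> S != set0 ->
  {in S &, forall a b, exists f, [/\ f \in F, a \in f & b \in f]} ->
  exists2 f, f \in F & S \subset f.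
Proof.
move=> acF /set0Pn[a aS] SF.
have [S1|] := boolP (S \subset [set a]).
  have [f [fF af _]] := SF a a aS aS; exists f => //.
  by rewrite (subset_trans S1) // sub1set.
case/subsetPn => b bS; rewrite inE => ba.
have [f [fF af bf]] := SF a b aS bS; exists f => //.
apply/subsetP => c cS; apply: contraT => cf.
have adc d : d \in S -> adj (F :\ f) d c.
  move=> dS; have [g [gF dg cg]] := SF d c dS cS; apply/adjP; exists g.
  by rewrite in_setD1 gF dg cg andbT; split=> //; apply: contraNneq cf => <-.
have := acF f a b fF af bf (connect_trans (connect1 (adc a aS)) _).
rewrite connect_adj_sym => /(_ (connect1 (adc b bS))) ab.
by rewrite ab eqxx in ba.
Qed.

(** * Strong colourings of acyclic families *)

Section Colouring.

Variable k : nat.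
Implicit Types (c : V -> 'I_k).

Definition strong_colouring F c := forall f, f \in F -> {in f &, injective c}.

(* By acyclicity the vertices of e lie in distinct components of F :\ e, so the
   colours can be permuted independently on each of these components. *)
Lemma recolour F e c (pi : V -> {perm 'I_k}) (rho : {perm 'I_k}) :
  acyclic F -> e \in F -> strong_colouring (F :\ e) c ->
  {in e &, injective (fun v => pi v (c v))} ->
  exists c', [/\ strong_colouring F c',
    forall v w, v \in e -> connect (adj (F :\ e)) v w -> c' w = pi v (c w) &
    forall w, (forall v, v \in e -> ~~ connect (adj (F :\ e)) v w) ->
      c' w = rho (c w)].
Proof.
move=> acF eF cP piI; set R := connect _.
(* The permutation depends only on the component of [w]; components that miss [e] all receive
   [rho]. *)
pose sig w := if [pick v in e | R v w] is Some v then pi v else rho.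
have sigE v w : v \in e -> R v w -> sig w = pi v.
  move=> ve vw; rewrite /sig; case: pickP => [u /andP[ue uw]|/(_ v)]; last first.
    by rewrite ve vw.
  congr pi; apply: (acF e) => //; apply: connect_trans uw _.
  by rewrite connect_adj_sym.
have sigC v w : R v w -> sig v = sig w.
  move=> vw; rewrite /sig; congr (if _ is Some v then pi v else rho).
  apply: eq_pick => u /=; congr (_ && _); apply/idP/idP => uw.
    exact: connect_trans uw vw.
  by apply: connect_trans uw _; rewrite /R connect_adj_sym.
exists (fun w => sig w (c w)); split.
- move=> f fF; have [->|fe] := eqVneq f e.
    move=> u v ue ve; rewrite (sigE u u) ?(sigE v v) /R ?connect0 //.
    exact: piI.
  move=> u v uf vf; have fF' : f \in F :\ e by rewrite in_setD1 fe.
  rewrite (sigC u v); last by apply/connect1/adjP; exists f.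
  by move=> /perm_inj; apply: cP fF' _ _ uf vf.
- by move=> v w ve vw; rewrite (sigE v w).
- move=> w nw; rewrite /sig; case: pickP => // v /andP[ve].
  by rewrite (negPf (nw _ ve)).
Qed.

Lemma perm_two (x x' y y' : 'I_k) : x != x' -> y != y' ->
  exists p : {perm 'I_k}, p x = y /\ p x' = y'.
Proof.
(* The first transposition moves [x] to [y]; the second moves the image of [x'] to [y'] and fixes
   [y]. *)
move=> xx yy; exists (tperm x y * tperm (tperm x y x') y')%g.
have yx' : tperm x y x' != y.
  by rewrite -[X in _ != X](tpermL x y) (inj_eq perm_inj) eq_sym.
split; rewrite permM; last exact: tpermL.
have y'y : y' != y by rewrite eq_sym.
by rewrite tpermL; apply: tpermD.
Qed.

Lemma colour_avoid (x y : 'I_k) : 3 <= k -> exists z, (z != x) && (z != y).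
Proof.
move=> k3; apply/existsP; apply: contraLR k3 => /existsPn xy.
rewrite -leqNgt -[k]card_ord -cardsT.
apply: leq_trans (_ : #|[set x; y]| <= 2); last by rewrite cards2; case: (_ != _).
apply/subset_leq_card/subsetP => z _; have := xy z.
by rewrite !inE negb_and !negbK.
Qed.

Lemma edge_colouring e : 0 < k -> #|e| <= k ->
  exists c, {in e &, injective c}.
Proof.
case: k => // k' _ ek; exists (fun v => inord (index v (enum e))).
have idx v : v \in e -> index v (enum e) < k'.+1.
  by move=> ve; apply: leq_trans ek; rewrite cardE index_mem mem_enum.
move=> u v ue ve /(congr1 val); rewrite /= !inordK ?idx // => uv.
by rewrite -(nth_index u (s := enum e) (x := u)) ?mem_enum // uv nth_index ?mem_enum.
Qed.

(** Induction on the number of edges: colour the family without [e], then permute the colours on the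
    components so that the vertices of [e] receive prescribed distinct colours. *)
Lemma acyclic_colouring F : 0 < k -> {in F, forall f, #|f| <= k} ->
  acyclic F -> exists c, strong_colouring F c.
Proof.
move=> k0; elim: {F}#|F| {-2}F (leqnn #|F|) => [|n IH] F.
  rewrite leqn0 cards_eq0 => /eqP-> _ _.
  by exists (fun=> Ordinal k0) => f; rewrite inE.
move=> Fn Fk acF; have [->|[e eF]] := set_0Vmem F.
  by exists (fun=> Ordinal k0) => f; rewrite inE.
have sub : F :\ e \subset F by apply: subD1set.
have [||c cP] := IH (F :\ e) _ _ (acyclicS sub acF).
- by have := cardsD1 e F; rewrite eF; lia.
- by move=> f /(subsetP sub)/Fk.
have [tgt tI] := edge_colouring k0 (Fk e eF).
have [|c' [c'P _ _]] := @recolour F e c (fun v => tperm (c v) (tgt v)) 1%g acF eF cP.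
  by move=> u v ue ve; rewrite !tpermL; apply: tI.
by exists c'.
Qed.

(* The case [same = false] is needed for the induction: when b is connected in
   F :\ e to a vertex v of e other than a, the colours of v and b must first be
   made distinct before b can be moved to the colour of a. *)
Lemma acyclic_pair_colouring F a b (same : bool) : 3 <= k ->
  {in F, forall f, #|f| <= k} -> acyclic F -> a != b ->
  (same -> {in F, forall f, ~~ ((a \in f) && (b \in f))}) ->
  exists2 c, strong_colouring F c & (c a == c b) = same.
Proof.
move=> k3; have k0 : 0 < k by apply: leq_trans k3.
(* For [s = false] the colour must differ from both [x] and [y], so a third one is needed. *)
have pick_colour (s : bool) (x y : 'I_k) : x != y ->
    exists z, (z != x) && ((y == z) == s).
  case: s => [|] xy; first by exists y; rewrite eq_sym xy !eqxx.
  have [z /andP[zx zy]] := colour_avoid x y k3; exists z.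
  by rewrite zx [y == z]eq_sym (negPf zy).
have [n] := ubnP #|F|; elim: n => // n IH in F a b same *.
rewrite ltnS => Fn Fk acF ab nab.
have [c0 c0P] := acyclic_colouring k0 Fk acF.
have [/exists_inP[e eF ae]|/exists_inPn aF] := boolP [exists e in F, a \in e]; last first.
  (* Here [a] lies on no edge, so its colour can be chosen freely. *)
  have [x xb] : exists x, (x == c0 b) = same.
    case: same {nab} => [|]; first by exists (c0 b); rewrite eqxx.
    by have [z /andP[/negPf zb _]] := colour_avoid (c0 b) (c0 b) k3; exists z.
  exists (fun v => if v == a then x else c0 v); last by rewrite eqxx [b == a]eq_sym (negPf ab).
  move=> f fF u v uf vf; have := aF f fF.
  case: eqP uf => [->-> //|_ uf]; case: eqP vf => [->-> //|_ vf _].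
  exact: c0P uf vf.
have sub : F :\ e \subset F by apply: subD1set.
have subP f : f \in F :\ e -> f \in F by apply/subsetP.
have Fn' : #|F :\ e| < n by have := cardsD1 e F; rewrite eF; lia.
have Fk' : {in F :\ e, forall f, #|f| <= k} by move=> f /subP/Fk.
have acF' := acyclicS sub acF.
have [tgt tI] := edge_colouring k0 (Fk e eF).
pose std c v := tperm (c v) (tgt v).
have stdI c : {in e &, injective (fun v => std c v (c v))}.
  by move=> u v ue ve; rewrite /std !tpermL; apply: tI.
(* If [a] and [b] are connected without [e], one permutation acts on both colours and the induction
   hypothesis for [F :\ e] suffices. *)
have [abR|abR] := boolP (connect (adj (F :\ e)) a b).
  have [|c cP cab] := IH (F :\ e) a b same Fn' Fk' acF' ab.
    by move=> /nab nab' f /subP; apply: nab'.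
  have [c' [c'P c'E _]] := recolour 1%g acF eF cP (stdI c).
  exists c' => //; rewrite (c'E a a) ?connect0 // (c'E a b) //.
  by rewrite (inj_eq perm_inj).
have [/exists_inP[v ve vb]|/exists_inPn nb] :=
    boolP [exists v in e, connect (adj (F :\ e)) v b].
  have va : v != a by apply: contraNneq abR => <-.
  (* If [v = b], then [a] and [b] share the edge [e]: equal colours are excluded by hypothesis, and
     distinct ones are automatic. *)
  have [vbE|vb'] := eqVneq v b.
    exists c0 => //; rewrite -vbE; case: same nab => [/(_ isT e eF)|_].
      by rewrite ae -vbE ve.
    by apply: contra_neqF va => /eqP/(c0P e eF) ->.
  have [//|c cP /negbT cvb] := IH (F :\ e) v b false Fn' Fk' acF' vb'.
  have tva : tgt v != tgt a by apply: contraNneq va => /tI ->.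
  have [z /andP[zv /eqP zP]] := pick_colour same _ _ tva.
  (* On the component of [v], the vertex [v] must receive its target colour while [b] receives [z],
     which equals [tgt a] exactly when [same] holds. *)
  have [p [pv pb]] : exists p : {perm 'I_k}, p (c v) = tgt v /\ p (c b) = z.
    by apply: perm_two; rewrite // eq_sym.
  pose pi u := if u == v then p else std c u.
  have piE u : pi u (c u) = tgt u.
    by rewrite /pi; case: eqP => [->|_] //; rewrite tpermL.
  have [|c' [c'P c'E _]] := recolour (pi := pi) 1%g acF eF cP.
    by move=> u w ue we; rewrite !piE; apply: tI.
  exists c' => //; rewrite (c'E a a) ?connect0 // (c'E v b) // piE.
  by rewrite /pi eqxx pb.
(* The component of [b] now misses [e], so [rho] alone moves the colour of [b] to [z]. *)
have [c cP] := acyclic_colouring k0 Fk' acF'.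
have [y ya] : exists y, y != tgt a.
  by have [y /andP[ya _]] := colour_avoid (tgt a) (tgt a) k3; exists y.
have [z /andP[_ /eqP zP]] := pick_colour same _ _ ya.
have [c' [c'P c'E c'rho]] := recolour (tperm (c b) z) acF eF cP (stdI c).
exists c' => //; rewrite (c'E a a) ?connect0 // c'rho // /std !tpermL.
by [].
Qed.

End Colouring.
End Acyclic.

(** * Vanishing of words and terms in the semiring *)

Section Evaluation.

Variable k : nat.

(** The empty set is sent to [None], the zero of the semiring. *)
Definition letters (A : {set 'I_k}) : Sc k := insub A.

(** The condition for a nonzero product. Repetitions in [s] count: a repeated variable fails, since
    a nonempty set is not disjoint from itself. *)
Definition disjoint_word (D : nat -> {set 'I_k}) (s : seq nat) :=
  all (fun y => D y != set0) s && pairwise (fun y z => [disjoint D y & D z]) s.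

Lemma all_disjoint_bigcup (D : nat -> {set 'I_k}) (A : {set 'I_k}) (s : seq nat) :
  all (fun y => [disjoint A & D y]) s = [disjoint A & \bigcup_(y <- s) D y].
Proof.
elim: s => [|y s IH] /=; first by rewrite big_nil disjoints_subset setC0 subsetT.
by rewrite big_cons IH -!setI_eq0 setIUr setU_eq0.
Qed.

Lemma bigcup_seq_neq0 (D : nat -> {set 'I_k}) (s : seq nat) : s != [::] ->
  all (fun y => D y != set0) s -> \bigcup_(y <- s) D y != set0.
Proof. by case: s => //= y s _ /andP[y0 _]; rewrite big_cons setU_eq0 negb_and y0. Qed.

Lemma Sc_mul_letters (A B : {set 'I_k}) : Sc_mul (letters A) (letters B) =
  if [&& A != set0, B != set0 & [disjoint A & B]] then letters (A :|: B) else None.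
Proof.
rewrite /letters; case: insubP => [A' A0 AE|/negPf->] //=.
rewrite A0; case: insubP => [B' B0 BE|/negPf->] //=.
rewrite AE BE B0; case: ifP => // _.
case: insubP => [C _ CE|]; last by rewrite setU_eq0 (negPf A0).
by congr Some; apply: val_inj; rewrite /= CE AE BE.
Qed.

Lemma big_Sc_mul_letters (D : nat -> {set 'I_k}) (s : seq nat) : s != [::] ->
  \big[oAC (@Sc_mulA k) (@Sc_mulC k)/None]_(y <- s) Some (letters (D y)) =
  Some (if disjoint_word D s then letters (\bigcup_(y <- s) D y) else None).
Proof.
elim: s => // y [|y' s] IH _.
  rewrite !big_cons !big_nil setU0 /disjoint_word /= !andbT; congr Some.
  by case: eqVneq => //= ->; rewrite /letters insubF ?eqxx.
rewrite big_cons IH // oACE [in RHS]big_cons; congr Some.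
move: (y' :: s) (isT : y' :: s != [::]) => {IH s}s s0.
rewrite /disjoint_word /= all_disjoint_bigcup.
have [sD|_] := boolP (all _ s); last by rewrite andbF /=; case: letters.
case: (pairwise _ s); last by rewrite !andbF; case: letters.
by rewrite Sc_mul_letters bigcup_seq_neq0 //= !andbT.
Qed.

Lemma word_enum_neq_nil (w : word) : (val w : seq nat) != [::].
Proof.
apply: contraNneq (valP w) => w0; apply/eqP/msetP => y.
by rewrite -count_mem_mset w0 mset0E.
Qed.

Lemma eval_word_zero (D : nat -> {set 'I_k}) (w : word) :
  (eval_word (fun y => letters (D y)) w == Some None) = ~~ disjoint_word D (val w).
Proof.
rewrite /eval_word big_Sc_mul_letters ?word_enum_neq_nil //.
case: ifP => [/andP[w0 _]|] //=.
rewrite /letters; case: insubP => //= /negP[].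
exact: bigcup_seq_neq0 (word_enum_neq_nil w) w0.
Qed.

(** Zero also absorbs under addition, so one vanishing word annihilates the sum. [Some None] is this
    zero, whereas [None] is the empty sum. *)
Lemma eval_term_zero (a : nat -> Sc k) (t : term) :
  (eval_term a t == Some None) = has (fun w => eval_word a w == Some None) (val t).
Proof.
rewrite /eval_term; elim: (val t : seq word) => [|w s IH]; first by rewrite big_nil.
rewrite big_cons /= -IH; case: (eval_word a w) => [r|] /=; last by rewrite Monoid.mul1m.
case: (bigop.body _ _ _) => [r'|]; last by rewrite Monoid.mulm1 orbF.
by case: r => [A|]; case: r' => [B|].
Qed.

Lemma ineq_holds_disjoint_word (D : nat -> {set 'I_k}) (q : word) (u : term) :
  ineq_holds k q u -> (forall w : word, w \in val u -> disjoint_word D (val w)) ->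
  disjoint_word D (val q).
Proof.
move=> /(_ (fun y => letters (D y)))/(congr1 (fun r => r == Some None)) + uD.
rewrite !eval_term_zero => h; apply: contraT; rewrite -eval_word_zero => q0.
move: h; have -> : has (fun w => eval_word (fun y => letters (D y)) w == Some None)
  (val (term_add (term_of_word q) u)).
  by apply/hasP; exists q => //; rewrite in_fsetU in_fset1 eqxx.
by case/esym/hasP => w /uD; rewrite eval_word_zero => ->.
Qed.

End Evaluation.

(** * Words of a substituted term *)

Section Substitution.

Lemma generator_subproof (y : nat) : ([mset y]%mset : {mset nat}%mset) != mset0.
Proof. by apply/eqP => /msetP/(_ y); rewrite msetnxx mset0E. Qed.

Definition generator (y : nat) : word := Sub [mset y]%mset (generator_subproof y).

Lemma perm_enum_msetD (A B : {mset nat}%mset) : perm_eq (msetD A B) (A ++ B).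
Proof.
apply/allP => y _ /=; rewrite count_cat.
by rewrite !count_mem_mset msetE2.
Qed.

Lemma word_generator_ind (P : word -> Prop) : (forall y, P (generator y)) ->
  (forall y w, P w -> P (word_mul (generator y) w)) -> forall w, P w.
Proof.
move=> Pg Pm w.
suff h (s : seq nat) (v : word) : s != [::] -> val v = seq_mset s -> P v.
  by apply: (h (val w)); rewrite ?word_enum_neq_nil ?seq_mset_id.
elim: s v => // y [|y' s] IH v _ vE.
  have -> : v = generator y.
    apply: val_inj; rewrite vE; apply/msetP => z.
    by rewrite mset_seqE msetnE /= addn0 eq_sym; case: eqP.
  exact: Pg.
have s0 : seq_mset (y' :: s) != mset0.
  by apply/eqP => /msetP/(_ y'); rewrite mset_seqE mset0E /= eqxx.
have -> : v = word_mul (generator y) (Sub (seq_mset (y' :: s)) s0).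
  apply: val_inj; rewrite vE; apply/msetP => z.
  by rewrite msetE2 !mset_seqE msetnE /= [z == y]eq_sym; case: (y == z).
by apply/Pm/IH.
Qed.

Lemma term_mulP (s t : term) (w : word) :
  reflect (exists v v', [/\ v \in val s, v' \in val t & w = word_mul v v'])
    (w \in val (term_mul s t)).
Proof.
apply: (iffP idP) => [/imfset2P[v vs [v' v't ->]]|[v [v' [vs v't ->]]]].
  by exists v, v'.
by apply/imfset2P; exists v => //; exists v'.
Qed.

Lemma term_of_word_mul (v w : word) :
  term_of_word (word_mul v w) = term_mul (term_of_word v) (term_of_word w).
Proof.
apply: val_inj; apply/fsetP => z; rewrite in_fset1.
apply/eqP/term_mulP => [->|[a [b []]]]; first by exists v, w; rewrite !in_fset1.
by rewrite !in_fset1 => /eqP-> /eqP->.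
Qed.

Lemma substitution_mem (phi : term -> term) (u : term) (w W : word) :
  substitution phi -> w \in val u -> W \in val (phi (term_of_word w)) ->
  W \in val (phi u).
Proof.
move=> [phiD _] wu Ww.
have -> : u = term_add (term_of_word w) u.
  apply: val_inj; apply/fsetP => v; rewrite in_fsetU in_fset1.
  by case: eqP => // ->.
by rewrite phiD in_fsetU Ww.
Qed.

(** The exponent of [z] in the word obtained from [w] by replacing every occurrence of each variable
    [y] by [sigma y]. *)
Definition value (sigma : nat -> word) (w : word) (z : nat) : nat :=
  \sum_(y <- val w) val (sigma y) z.

Lemma value_generator sigma y z : value sigma (generator y) z = val (sigma y) z.
Proof. by rewrite /value enum_msetn big_seq1. Qed.

Lemma value_mul sigma v w z :
  value sigma (word_mul v w) z = value sigma v z + value sigma w z.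
Proof. by rewrite /value (perm_big _ (perm_enum_msetD _ _)) big_cat. Qed.

Lemma value_substitution phi sigma (w : word) : substitution phi ->
  (forall y, sigma y \in val (phi (term_of_word (generator y)))) ->
  exists2 W, W \in val (phi (term_of_word w)) & val W =1 value sigma w.
Proof.
move=> [_ phiM] sg; elim/word_generator_ind: w => [y|y w [W Ww WE]].
  by exists (sigma y) => // z; rewrite value_generator.
exists (word_mul (sigma y) W).
  by rewrite term_of_word_mul phiM; apply/term_mulP; exists (sigma y), W.
by move=> z; rewrite value_mul value_generator msetE2 WE.
Qed.

Lemma generator_choice (phi : term -> term) : exists sigma : nat -> word,
  forall y, sigma y \in val (phi (term_of_word (generator y))).
Proof.
exists (fun y => xchoose (fset0Pn _ (valP (phi (term_of_word (generator y)))))).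
by move=> y; apply: (xchooseP (fset0Pn _ (valP (phi (term_of_word (generator y)))))).
Qed.

(** Linearity of [w] matters: two occurrences of one variable could contribute different words of
    its image, which no single [sigma] describes. *)
Lemma substitution_value phi (w W : word) : substitution phi -> uniq (val w) ->
  W \in val (phi (term_of_word w)) ->
  exists2 sigma, forall y, sigma y \in val (phi (term_of_word (generator y))) &
    val W =1 value sigma w.
Proof.
move=> [_ phiM]; elim/word_generator_ind: w W => [y|y w IH] W.
  move=> _ Wy; have [sigma sg] := generator_choice phi.
  exists (fun z => if z == y then W else sigma z) => z.
    by case: eqP => [->|].
  by rewrite value_generator eqxx.
rewrite (perm_uniq (perm_enum_msetD _ _)) enum_msetn /= => /andP[yw wU].
rewrite term_of_word_mul phiM => /term_mulP[v [W' [vy W'w ->]]].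
have [sigma sg W'E] := IH W' wU W'w.
exists (fun z => if z == y then v else sigma z) => z.
  by case: eqP => [->|].
rewrite value_mul value_generator eqxx msetE2 W'E; congr (_ + _).
apply: eq_big_seq => y' y'w; case: eqP => // yE.
by rewrite -yE y'w in yw.
Qed.

End Substitution.

(** * Sums of exponents and finite choice *)

Lemma sum_nat_mem_leq (T : eqType) (s : seq T) (f : T -> nat) (y : T) :
  y \in s -> f y <= \sum_(z <- s) f z.
Proof. by move=> ys; rewrite (big_rem y) //= leq_addr. Qed.

Lemma sum_nat_gt0_mem (T : eqType) (s : seq T) (f : T -> nat) :
  0 < \sum_(z <- s) f z -> exists2 y, y \in s & 0 < f y.
Proof.
rewrite lt0n sum_nat_seq_neq0 => /hasP[y ys /=].
by rewrite -lt0n; exists y.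
Qed.

Lemma pairwise_mem (T : eqType) (r : rel T) (s : seq T) y z : symmetric r ->
  pairwise r s -> y \in s -> z \in s -> y != z -> r y z.
Proof.
move=> rC; elim: s => //= a s IH /andP[/allP as_ sP]; rewrite !inE.
case/predU1P=> [->|ys] /predU1P[->|zs].
- by rewrite eqxx.
- by move=> _; apply: as_.
- by move=> _; rewrite rC; apply: as_.
- exact: IH.
Qed.

Lemma sum_leq1_pairwise (T : eqType) (V : finType) (f : T -> V -> nat) (s : seq T) :
  (forall v, \sum_(y <- s) f y v <= 1) ->
  pairwise (fun y z => [disjoint [set v | 0 < f y v] & [set v | 0 < f z v]]) s.
Proof.
elim: s => //= y s IH s1; apply/andP; split; last first.
  by apply: IH => v; have := s1 v; rewrite big_cons; lia.
apply/allP => z zs; rewrite -setI_eq0; apply/eqP/setP => v; rewrite !inE.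
have := s1 v; rewrite big_cons; have := sum_nat_mem_leq (fun t => f t v) zs.
by move=> /=; lia.
Qed.

Lemma finite_choice (T : eqType) (U : finType) (s : seq T) (E : {set U})
    (R : T -> U -> Prop) : (forall y, y \in s -> exists2 e, e \in E & R y e) ->
  exists F : {set U}, [/\ F \subset E, #|F| <= size s &
    forall y, y \in s -> exists2 e, e \in F & R y e].
Proof.
elim: s => [|y s IH] sE; first by exists set0; rewrite sub0set cards0.
have [|F [FE Fs FR]] := IH; first by move=> z zs; apply: sE; rewrite inE zs orbT.
have [e eE ye] := sE y (mem_head y s).
exists (e |: F); split.
- by rewrite subUset sub1set eE.
- by rewrite cardsU1 /=; case: (e \in F) => //=; lia.
- move=> z; rewrite inE => /predU1P[->|/FR[f fF zf]].
    by exists e => //; rewrite setU11.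
  by exists f => //; rewrite setU1r.
Qed.

(** * Transfer of the hypergraph property from [u] to [q] *)

Section Invariance.

Variables (k : nat) (V : finType) (H : hypergraph V) (x : V -> nat).
Hypothesis xI : injective x.

Implicit Types (p : option term) (P : nat -> nat).

(** The condition on a single word, stated for exponent functions so that it also covers a sum with
    a possibly empty context. *)
Definition fits (m : nat -> nat) :=
  (forall z, m z <= 1) /\
  exists2 e : {set V}, e \in hyperedges H &
    forall z, 0 < m z -> exists2 v, v \in e & z = x v.

Lemma prop_P_fits (t : term) :
  prop_P H x t <-> forall w, w \in val t -> fits (val w).
Proof.
split=> tP w wt.
- have [wl [B [e eE Be] wB]] := tP w wt; split.
    move=> z; have [|] := boolP (z \in content w); first by move/wl ->.
    by rewrite /content mem_finsupp negbK => /eqP->.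
  exists e => // z; rewrite lt0n -mem_finsupp -/(content w) wB.
  by case/imfsetP=> v /= vB ->; exists v => //; apply: (subsetP Be).
- have [w1 [e eE we]] := tP w wt; split.
    move=> z; rewrite /content mem_finsupp => z0.
    by have := w1 z; case: (val w z) z0 => [|[]].
  exists [set v in e | 0 < val w (x v)].
    by exists e => //; apply/subsetP => v; rewrite inE => /andP[].
  apply/fsetP => z; rewrite /content mem_finsupp -lt0n.
  apply/idP/imfsetP => [z0|[v /=]].
    by have [v ve zE] := we z z0; exists v => //=; rewrite inE ve -zE.
  by rewrite inE => /andP[_ v0 ->].
Qed.

(* P plays the role of the word chosen in the multiplicative context. *)
Lemma fits_inequality (N : nat) (q : word) (u : term) (sigma : nat -> word)
    (P : nat -> nat) :
  3 <= k -> uniform H k -> girth_gt H N -> ineq_holds k q u -> nwords u <= N ->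
  (forall w : word, w \in val u -> fits (fun z => P z + value sigma w z)) ->
  uniq (val q) /\ fits (fun z => P z + value sigma q z).
Proof.
move=> k3 Hk HN qu uN uF; have k0 : 0 < k by lia.
have [F [FH Fu FP]] := finite_choice (fun w wu => (uF w wu).2).
have acF : acyclic F by apply: girth_gt_acyclic HN FH _; apply: leq_trans Fu uN.
have Fk : {in F, forall f : {set V}, #|f| <= k}.
  by move=> f /(subsetP FH)/Hk ->.
pose C y := [set v | 0 < val (sigma y) (x v)].
pose occ y := has (fun w : word => y \in (val w : seq nat)) (val u).
(* Variables absent from [u] are sent to zero, so that a nonzero value of [q] forces all its
   variables to occur in [u]. *)
pose D (c : V -> 'I_k) y := if occ y then c @: C y else set0.
have occP (w : word) y : w \in val u -> y \in (val w : seq nat) -> occ y.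
  by move=> wu yw; apply/hasP; exists w.
have sigma_le (w : word) y z : y \in (val w : seq nat) ->
    val (sigma y) z <= value sigma w z.
  by move=> yw; apply: (sum_nat_mem_leq (fun y => val (sigma y) z)).
have occ_ne y : occ y -> C y != set0.
  case/hasP => w wu yw; have [e eF we] := FP w wu.
  have [z z0] : exists z, 0 < val (sigma y) z.
    have := count_mem_mset^~ (val (sigma y)).
    case: (val (sigma y) : seq nat) (word_enum_neq_nil (sigma y)) => // z s _ sE.
    by exists z; rewrite -sE /= eqxx.
  have [|v _ zE] := we z; first by have := sigma_le w y z yw; lia.
  by apply/set0Pn; exists v; rewrite inE -zE.
(* All vertices of the substituted [w] lie on one edge, where [c] is injective, so disjoint vertex
   sets have disjoint colour sets. *)
have edge_colours (c : V -> 'I_k) (w : word) : strong_colouring F c -> w \in val u ->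
    disjoint_word (D c) (val w).
  move=> cP wu; have [w1 _] := uF w wu; have [e eF we] := FP w wu.
  have Ce y : y \in (val w : seq nat) -> C y \subset e.
    move=> yw; apply/subsetP => v; rewrite inE => v0.
    have [|v' v'e /xI-> //] := we (x v).
    by have := sigma_le w y (x v) yw; lia.
  apply/andP; split.
    apply/allP => y yw; rewrite /D (occP w y) //.
    by rewrite imset_eq0 occ_ne // (occP w).
  have : pairwise (fun y z => [disjoint C y & C z]) (val w).
    apply: (sum_leq1_pairwise (f := fun y v => val (sigma y) (x v))) => v.
    exact: leq_trans (leq_addl _ _) (w1 (x v)).
  apply: (sub_in_pairwise (P := mem (val w : seq nat))); last exact/allP.
  move=> y z yw zw yz; rewrite /D (occP w y) // (occP w z) //.
  rewrite -setI_eq0; apply/eqP/setP => i; rewrite !inE.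
  apply/negP => /andP[/imsetP[a ay ->] /imsetP[b bz]].
  move=> /(cP e eF _ _ (subsetP (Ce y yw) _ ay) (subsetP (Ce z zw) _ bz)) ab.
  by have := disjointFr yz ay; rewrite ab bz.
have q_colours c : strong_colouring F c -> disjoint_word (D c) (val q).
  by move=> cP; apply: ineq_holds_disjoint_word qu _ => w; apply: edge_colours.
have [c0 c0P] := acyclic_colouring k0 Fk acF.
have q_occ y : y \in (val q : seq nat) -> occ y.
  move=> yq; have /andP[/allP/(_ y yq) + _] := q_colours c0 c0P.
  by rewrite /D; case: ifP => //; rewrite eqxx.
have D_ne c y : occ y -> D c y != set0.
  by move=> yo; rewrite /D yo imset_eq0 occ_ne.
have qU : uniq (val q).
  have /andP[_] := q_colours c0 c0P; rewrite uniq_pairwise.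
  apply: (sub_in_pairwise (P := mem (val q : seq nat))); last exact/allP.
  move=> y z yq zq yz /=; apply: contraTneq yz => <-.
  by rewrite -setI_eq0 setIid D_ne // q_occ.
split=> //.
have q_disj (c : V -> 'I_k) y z a b : strong_colouring F c -> y \in (val q : seq nat) ->
    z \in (val q : seq nat) -> y != z -> a \in C y -> b \in C z -> c a != c b.
  move=> cP yq zq yz ay bz; have /andP[_ qp] := q_colours c cP.
  have := pairwise_mem (fun _ _ => disjoint_sym _ _) qp yq zq yz.
  rewrite /D !q_occ // => yzD.
  apply/eqP => cab; have := disjointFr yzD (imset_f c ay).
  by rewrite cab imset_f.
have /fset0Pn[w0 w0u] := valP u.
have supp z : 0 < P z + value sigma q z -> 0 < P z \/
    exists y v, [/\ y \in (val q : seq nat), v \in C y & z = x v].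
  case: (posnP (P z)) => [->|]; last by left.
  rewrite add0n => /sum_nat_gt0_mem[y yq y0]; right; exists y.
  have /hasP[w wu yw] := q_occ y yq; have [e eF we] := FP w wu.
  have [|v _ zE] := we z; first by have := sigma_le w y z yw; lia.
  by exists v; rewrite yq inE -zE.
split.
  move=> z; case: (posnP (value sigma q z)) => [->|/sum_nat_gt0_mem[y yq y0]].
    by have := (uF w0 w0u).1 z; lia.
  have /hasP[w wu yw] := q_occ y yq.
  (* A second variable of [q] contributing [z] would share a vertex, hence a colour, with [y]. *)
  suff -> : value sigma q z = val (sigma y) z.
    by have := (uF w wu).1 z; have := sigma_le w y z yw; lia.
  rewrite /value (bigD1_seq y) //= big_seq_cond big1 ?addn0 // => y' /andP[y'q y'y].
  apply/eqP; rewrite -leqn0 leqNgt; apply/negP => y'0.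
  have [e eF we] := FP w wu.
  have [|v _ zE] := we z; first by have := sigma_le w y z yw; lia.
  by have := q_disj c0 y' y v v c0P y'q yq y'y; rewrite !inE -zE y0 y'0 eqxx; auto.
pose S := [set v | 0 < P (x v) + value sigma q (x v)].
have [||f fF Sf] := @acyclic_clique _ F S acF.
- have [y yq] : exists y, y \in (val q : seq nat).
    by case: (val q : seq nat) (word_enum_neq_nil q) => // y s _; exists y; rewrite mem_head.
  have /set0Pn[v vy] := occ_ne y (q_occ y yq); apply/set0Pn; exists v.
  by move: vy; rewrite !inE; have := sigma_le q y (x v) yq; lia.
- have inC (w : word) y v : y \in (val w : seq nat) -> v \in C y ->
      0 < P (x v) + value sigma w (x v).
    by move=> yw; rewrite inE; have := sigma_le w y (x v) yw; lia.
  have inP w v : 0 < P (x v) -> 0 < P (x v) + value sigma w (x v) by lia.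
  have together (w : word) a b : w \in val u ->
      0 < P (x a) + value sigma w (x a) -> 0 < P (x b) + value sigma w (x b) ->
      exists f, [/\ f \in F, a \in f & b \in f].
    move=> wu wa wb; have [e eF we] := FP w wu; exists e.
    by have [v ve /xI->] := we _ wa; have [v' v'e /xI->] := we _ wb.
  have SP v : v \in S -> 0 < P (x v) \/
      exists2 y, y \in (val q : seq nat) & v \in C y.
    rewrite inE => /supp[]; first by left.
    by case=> y [v' [yq v'y /xI->]]; right; exists y.
  move=> a b /SP[Pa|[y yq ay]] /SP[Pb|[z zq bz]].
  + by apply: (together w0 a b w0u); apply: inP.
  + have /hasP[w wu zw] := q_occ z zq.
    by apply: (together w a b wu); [apply: inP | apply: inC zw bz].
  + have /hasP[w wu yw] := q_occ y yq.
    by apply: (together w a b wu); [apply: inC yw ay | apply: inP].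
  + have /hasP[w wu yw] := q_occ y yq.
    have [yz|yz] := eqVneq y z.
      by apply: (together w a b wu); apply: inC yw _; rewrite // yz.
    have [ab|ab] := eqVneq a b.
      by apply: (together w a b wu); apply: inC yw _; rewrite // -ab.
    (* Two vertices from different variables of [q] and on no common edge could be coloured alike,
       against [q_disj]. *)
    apply/adjP; apply: contraT => nab.
    have [|c cP /eqP cab] := acyclic_pair_colouring (same := true) k3 Fk acF ab.
      move=> _ f fF; apply: contraNN nab => /andP[af bf].
      by apply/adjP; exists f.
    by have := q_disj c y z a b cP yq zq yz ay bz; rewrite cab eqxx.
exists f; first exact: (subsetP FH).
move=> z z0; case: (supp z z0) => [Pz|[y [v [yq vy zE]]]].
  have [e eF we] := FP w0 w0u.
  have [|v _ zE] := we z; first by lia.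
  by exists v => //; apply: (subsetP Sf); rewrite inE -zE.
by exists v => //; apply: (subsetP Sf); rewrite inE -zE.
Qed.

(** The zero function stands for the formal empty word. *)
Definition context_value (p : option term) (P : nat -> nat) : Prop :=
  if p is Some p' then exists2 v : word, v \in val p' & P =1 val v
  else P =1 fun=> 0.

Lemma context_value_exists p : exists P, context_value p P.
Proof.
case: p => [p|]; last by exists (fun=> 0).
by have /fset0Pn[v vp] := valP p; exists (val v), v.
Qed.

Lemma in_mul_context_decomp p (s : term) (W : word) :
  W \in val (in_mul_context p s) -> exists P W',
    [/\ context_value p P, W' \in val s & forall z, val W z = P z + val W' z].
Proof.
case: p => [p|] /=; last by exists (fun=> 0), W.
move=> /term_mulP[v [W' [vp W's ->]]]; exists (val v), W'; split=> // [|z].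
  by exists v.
by rewrite msetE2.
Qed.

Lemma in_mul_context_word p P (s : term) (W : word) :
  context_value p P -> W \in val s ->
  exists2 W', W' \in val (in_mul_context p s) & forall z, val W' z = P z + val W z.
Proof.
case: p => [p [v vp PE] Ws|P0 Ws]; last first.
  by exists W => // z; rewrite P0.
exists (word_mul v W) => [|z]; first by apply/term_mulP; exists v, W.
by rewrite msetE2 PE.
Qed.

End Invariance.

(** * Invariance under one elementary application *)

Theorem lemma6p5 (k : nat) (hk : 3 <= k)
  (Delta : word -> term -> Prop)
  (hDelta : forall (q : word) (u : term), Delta q u -> ineq_holds k q u)
  (N : nat) (hN : 1 <= N)
  (hDeltaN : forall (q : word) (u : term), Delta q u -> nwords u <= N)
  (V : finType) (H : hypergraph V)
  (hunif : uniform H k) (hgirth : girth_gt H N)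
  (x : V -> nat) (hx : injective x)
  (t t' : term) (ht : prop_P H x t)
  (happ : elementary_application Delta t t') :
  prop_P H x t'.
Proof.
case: happ => q [u [phi [p [d [Dqu phiS tE]]]]]; set lhs := in_add_context d _ in tE.
apply/prop_P_fits => W; move/prop_P_fits: ht => ht.
have in_addP (s : term) v : v \in val (in_add_context d s) <->
    v \in val s \/ (if d is Some d' then v \in val d' else false).
  case: d {lhs tE} => [d|] /=; last by split=> [|[]//]; left.
  by rewrite in_fsetU; split=> /orP.
have in_sumP (s r : term) v : v \in val (term_add s r) <-> v \in val s \/ v \in val r.
  by rewrite in_fsetU; split=> /orP.
(* Deleting summands is harmless; in the other direction only the words of the substituted [q] in
   its context are new. *)
case: tE => [[tE ->]|[tE ->]]; last first.
  move=> /in_addP Wl; apply: ht; rewrite tE; apply/in_addP.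
  by case: Wl => [Wl|]; [left; apply/in_sumP; left | right].
move=> /in_addP[/in_sumP[Wl|Wq]|Wd]; try by apply: ht; rewrite tE; apply/in_addP; auto.
have pu_fits sigma P : context_value p P ->
    (forall y, sigma y \in val (phi (term_of_word (generator y)))) ->
    forall w : word, w \in val u -> fits H x (fun z => P z + value sigma w z).
  move=> pP sg w wu; have [W' W'w W'E] := value_substitution w phiS sg.
  have W'u := substitution_mem phiS wu W'w.
  have [v vpu vE] := in_mul_context_word pP W'u.
  have [v1 [e eE ve]] : fits H x (val v).
    by apply: ht; rewrite tE; apply/in_addP; left.
  split=> [z|]; first by rewrite -W'E -vE.
  by exists e => // z; rewrite -W'E -vE; apply: ve.
have key sigma P pP sg := fits_inequality hx hk hunif hgirth (hDelta q u Dqu)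
  (hDeltaN q u Dqu) (pu_fits sigma P pP sg).
(* A first use of [key] with arbitrary choices gives the linearity of [q]; only then can the given
   word [W'] be described by some [sigma], to which [key] is applied again. *)
have [sigma0 sg0] := generator_choice phi.
have [P0 P0p] := context_value_exists p.
have [qU _] := key sigma0 P0 P0p sg0.
move: Wq => /in_mul_context_decomp[P [W' [pP W'q WE]]].
have [sigma sg W'E] := substitution_value phiS qU W'q.
have [_ [W1 [e eE We]]] := key sigma P pP sg.
split=> [z|]; first by rewrite WE W'E.
by exists e => // z; rewrite WE W'E; apply: We.
Qed.
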